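(* There exists a complete connected metric space whose each separable subset is zero-dimensional. In particular, there exists a complete nonseparably connected metric space.
   Context: A topological space is zero-dimensional if it has a base consisting of clopen sets; subsets carry the subspace topology. A nonseparably connected space is a connected topological space all of whose connected separable subsets are singletons. *)

(* Defs.v *)
From HB Require Import structures.
From mathcomp Require Import all_boot all_order all_algebra.
From mathcomp Require Import all_classical all_reals.
From mathcomp Require Import topology.
(* MathComp-Analysis *)

Set Implicit Arguments.
Unset Strict Implicit.
Unset Printing Implicit Defensive.

Local Open Scope classical_set_scope.

(* The property packaged in the library's [Complete] structure, whose carrier
   must in addition be pointed.  For a [metricType], the entourages are
   generated by the balls of the distance [mdist]. *)
Definition complete_space (T : uniformType) : Prop :=
  forall F : set_system T, ProperFilter F -> cauchy F -> exists l : T, F --> l.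

(* A subset [A : set X] is regarded as a space through its coercion to the type
   [set_type A], which carries the initial topology of the inclusion. *)
Definition separable_space (T : topologicalType) : Prop :=
  exists2 D : set T, countable D & dense D.

(* The library's [zero_dimensional] is a different notion: it only asks that
   distinct points be separated by a clopen set. *)
Definition zero_dimensional_space (T : topologicalType) : Prop :=
  exists2 B : set (set T), B `<=` clopen & basis B.

(* [connected] holds of the empty set, which therefore has to be excluded. *)
Definition nonseparably_connected (T : topologicalType) : Prop :=
  connected [set: T] /\
  forall A : set T, A !=set0 -> connected A -> separable_space A ->
    exists x : T, A = [set x].

(* A one-point space is complete, connected and separable, and satisfies the
   other definitions vacuously; existence claims must exclude it. *)
Definition two_points (T : Type) : Prop := exists x y : T, x <> y.

(* Main.v *)
(* Over a metric space Y build the cobweb Y': a hedgehog with apex a_y is placed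
   over every y, with one spine for each x in Y, and the free end of the spine
   (y, x) is put at distance d(y, x) from the free end of (x, x), so that these
   ends form a star around (x, x).  The projection Y' -> Y has connected fibres,
   and x' |-> the end of (x', x) is a section continuous at x.  Apart from the
   ends, the spines are open and disjoint, whence separable subsets of Y' have
   countable projections.  X is the inverse limit of the iterated cobwebs over
   the real line.

   If A is separable in X, all its projections are countable, and so are the sets
   of distances d(a, A): balls of the omitted radii are clopen in A.

   If P is a locally constant predicate on X that is not constant, then, by
   connectedness of the base and the sections, P is not constant on the fibre of X
   over some y_0; by connectedness of the hedgehog over y_0, it is not constant
   over some y_1 in that hedgehog, and so on.  P is not locally constant at the
   thread (y_0, y_1, ...). *)
Require Import Defs.
From HB Require Import structures.
From mathcomp Require Import all_boot all_order all_algebra.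
From mathcomp Require Import all_classical all_reals.
From mathcomp Require Import topology.
From mathcomp Require Import normedtype lebesgue_measure ring lra.

Set Implicit Arguments.
Unset Strict Implicit.
Unset Printing Implicit Defensive.

Import Order.TTheory GRing.Theory Num.Theory.

Local Open Scope classical_set_scope.
Local Open Scope ring_scope.

(** * Filters in metric spaces *)

Section MetricSpaces.
Context {R : realType}.

Lemma cauchy_mdist (T : metricType R) (F : set_system T) :
  ProperFilter F -> cauchy F -> forall e, 0 < e ->
  exists2 A, F A & forall a b, A a -> A b -> mdist a b < e.
Proof.
move=> PF /cauchyP cF e e0; have e20 : 0 < e / 2 by lra.
have [x Fx] := cF _ e20; exists (ball x (e / 2)) => // a b.
rewrite ballEmdist /= => xa xb.
have := metric_triangle a x b; rewrite (metric_sym a x) => /le_lt_trans; apply; lra.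
Qed.

Lemma cvg_mdist (T : metricType R) (F : set_system T) (l : T) : Filter F ->
  (forall e, 0 < e -> F [set a | mdist l a < e]) -> F --> l.
Proof.
move=> FF h; apply/cvg_ballP => e e0.
by rewrite ballEmdist; exact: h.
Qed.

End MetricSpaces.

(** * The metric of the cobweb *)

Section Cobweb.
Context {R : realType} {Y : metricType R}.
Implicit Types u v w : Y * Y * R.

(* [(y, x, t)] is the point at height [t] of the spine [x] over [y]; the apex, at
   height [0] of all spines over [y], is represented by [(y, y, 0)] only. *)
Definition cobweb_dist u v : R :=
  let: (y, x, t) := u in let: (y', x', t') := v in
  if y == y' then if x == x' then `|t - t'| else Num.min 1 (t + t')
  else if x == x' then Num.min 1 (2 - t - t' + mdist y x + mdist y' x')
  else 1.

Definition cobweb_point u :=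
  [&& 0 <= u.2, u.2 <= 1 & (u.2 == 0) ==> (u.1.1 == u.1.2)].

Lemma cobweb_distxx u : cobweb_dist u u = 0.
Proof. by case: u => [[y x] t] /=; rewrite !eqxx subrr normr0. Qed.

Lemma cobweb_dist_sym u v : cobweb_dist u v = cobweb_dist v u.
Proof.
case: u v => [[y x] t] [[y' x'] t'] /=.
rewrite (eq_sym y') (eq_sym x') distrC (addrC t').
by do ![case: ifP => // _]; congr Num.min; ring.
Qed.

(** In the main case [u] and [w] differ in foot and tip: either one leg is already [1], or the
    detour through [v] traverses a whole spine. *)
Lemma cobweb_dist_triangle v u w :
  cobweb_point u -> cobweb_point v -> cobweb_point w ->
  cobweb_dist u w <= cobweb_dist u v + cobweb_dist v w.
Proof.
case: u v w => [[y x] t] [[y' x'] t'] [[y'' x''] t''].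
rewrite /cobweb_point /= => /and3P[t0 t1 _] /and3P[t'0 t'1 _] /and3P[t''0 t''1 _].
have := mdist_ge0 y x; have := mdist_ge0 y' x'; have := mdist_ge0 y'' x''.
have := ler_norm (t - t'); have := ler_norm (t' - t).
have := ler_norm (t' - t''); have := ler_norm (t'' - t').
rewrite -[`|t' - t|]distrC -[`|t'' - t'|]distrC.
have [?|y12] := eqVneq y y'; have [?|x12] := eqVneq x x';
  have [?|y13] := eqVneq y y''; have [?|x13] := eqVneq x x'';
  have [?|y23] := eqVneq y' y''; have [?|x23] := eqVneq x' x''; subst;
  try congruence.
all: try match goal with H : is_true (?a != ?a) |- _ => by rewrite eqxx in H end.
all: rewrite ?minEle; do ?[case: ifP => * ].
all: rewrite ?ler_norml; try (apply/andP; split); try lra.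
Qed.

End Cobweb.

Section CobwebSpace.
Context {R : realType} (Y : metricType R).

Definition cobweb := {u : Y * Y * R | cobweb_point u}.

HB.instance Definition _ := Choice.on cobweb.

Implicit Types p q : cobweb.

Definition foot p : Y := (val p).1.1.
Definition tip p : Y := (val p).1.2.
Definition height p : R := (val p).2.

Lemma height_itv p : 0 <= height p <= 1.
Proof. by case: p => u h; case/and3P: (h) => ? ? _; apply/andP. Qed.

Lemma tip_apex p : height p = 0 -> tip p = foot p.
Proof.
case: p => u h; case/and3P: (h) => _ _ /implyP h0.
by rewrite /height /tip /foot /= => /eqP/h0/eqP.
Qed.

Lemma cobweb_eq p q :
  foot p = foot q -> tip p = tip q -> height p = height q -> p = q.
Proof.
case: p q => [[[y x] t] ?] [[[y' x'] t'] ?]; rewrite /foot/tip/height/= => ? ? ?.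
by apply: val_inj; congr (_, _, _).
Qed.

Let dist p q : R := cobweb_dist (val p) (val q).

Let distE p q : dist p q =
  if foot p == foot q then if tip p == tip q then `|height p - height q|
    else Num.min 1 (height p + height q)
  else if tip p == tip q then Num.min 1 (2 - height p - height q +
    mdist (foot p) (tip p) + mdist (foot q) (tip q))
  else 1.
Proof. by case: p q => [[[y x] t] ?] [[[y' x'] t'] ?]. Qed.

Let dist_eq0 p q : dist p q = 0 -> p = q.
Proof.
have /andP[p0 p1] := height_itv p; have /andP[q0 q1] := height_itv q.
have d0 := mdist_ge0 (foot p) (tip p); have d'0 := mdist_ge0 (foot q) (tip q).
rewrite distE; case: eqP => [r|r]; case: eqP => [t|t].
- by move/normr0_eq0/subr0_eq; exact: cobweb_eq.
- rewrite minEle; case: ifP => _ h; first by exfalso; lra.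
  by case: t; rewrite !tip_apex//; lra.
- rewrite minEle; case: ifP => _ h; first by exfalso; lra.
  have rp : foot p = tip p by apply: (@mdist_positivity R); lra.
  have rq : foot q = tip q by apply: (@mdist_positivity R); lra.
  by case: r; rewrite rp rq.
- by move=> h; exfalso; lra.
Qed.

HB.instance Definition _ := @isMetric.Build R cobweb dist
  (fun p => cobweb_distxx (val p)) dist_eq0
  (fun p q => cobweb_dist_sym (val p) (val q))
  (fun p q r => cobweb_dist_triangle (valP q) (valP p) (valP r)).

Lemma cobweb_mdistE p q : mdist p q =
  if foot p == foot q then if tip p == tip q then `|height p - height q|
    else Num.min 1 (height p + height q)
  else if tip p == tip q then Num.min 1 (2 - height p - height q +
    mdist (foot p) (tip p) + mdist (foot q) (tip q))
  else 1.
Proof. exact: distE. Qed.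

Lemma height_lip p q : `|height p - height q| <= mdist p q.
Proof.
have /andP[p0 p1] := height_itv p; have /andP[q0 q1] := height_itv q.
have := mdist_ge0 (foot p) (tip p); have := mdist_ge0 (foot q) (tip q).
rewrite cobweb_mdistE; case: ifP => _; case: ifP => _ // d0 d1;
  rewrite ?minEle; try case: ifP => _; rewrite ler_norml; apply/andP; split; lra.
Qed.

(** Below the cap, feet differ only if the tips agree, and then the distance includes the detour
    between the feet through the common tip. *)
Lemma foot_lip p q : mdist p q < 1 -> mdist (foot p) (foot q) <= mdist p q.
Proof.
have /andP[p0 p1] := height_itv p; have /andP[q0 q1] := height_itv q.
rewrite cobweb_mdistE; case: eqP => [->|_]; first by rewrite mdistxx; case: ifP => // _;
  rewrite ?normr_ge0 // le_min ler01 addr_ge0.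
case: eqP => [e|]; last by rewrite ltxx.
rewrite minEle; case: ifP; rewrite ?ltxx// => _ _.
have := metric_triangle (foot p) (tip p) (foot q).
rewrite (metric_sym (tip p)) -e; lra.
Qed.

(** Source of the countable projections: changing the foot costs at least
    [Num.min 1 (mdist (foot p) (tip p))]; when this vanishes, [foot p = tip p] is the tip that a
    nearby [q] shares. *)
Lemma foot_near p : exists2 e, 0 < e & forall q, mdist p q < e ->
  foot p = foot q \/ foot p = tip q.
Proof.
have /andP[p0 p1] := height_itv p.
have [rt|rt] := eqVneq (foot p) (tip p).
  exists 1 => // q; rewrite cobweb_mdistE.
  case: eqP => [|_]; first by left.
  by rewrite rt; case: eqP => [|_]; [right | rewrite ltxx].
exists (Num.min 1 (mdist (foot p) (tip p))).
  by rewrite lt_min ltr01 mdist_gt0.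
move=> q; have /andP[q0 q1] := height_itv q.
rewrite lt_min cobweb_mdistE => /andP[].
case: eqP => [|_]; first by left.
case: eqP => [_|_]; last by rewrite ltxx.
have := mdist_ge0 (foot q) (tip q).
rewrite minEle; case: ifP => _ *; exfalso; lra.
Qed.

(* Clamping [s] to [[0, 1]] makes spines total functions on the real line. *)
Lemma spine_point (y x : Y) (s : R) : let t := Num.max 0 (Num.min 1 s) in
  cobweb_point (y, if t == 0 then y else x, t).
Proof.
rewrite /cobweb_point /= le_max lexx ge_max ler01 ge_min lexx /=.
by apply/implyP => ->.
Qed.

Definition spine y x s : cobweb :=
  exist (fun u => is_true (cobweb_point u)) _ (spine_point y x s).

Lemma spine_lip y x s s' : mdist (spine y x s) (spine y x s') <= `|s - s'|.
Proof.
rewrite cobweb_mdistE eqxx /tip/height /=.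
set t := Num.max _ _; set t' := Num.max _ _.
have tt' : `|t - t'| <= `|s - s'|.
  have := ler_norm (s - s'); have := ler_norm (s' - s); rewrite distrC.
  rewrite /t /t' !minEle; do ?[case: ifP => * ];
    rewrite !maxEle; do ?[case: ifP => * ]; rewrite ler_norml; apply/andP; split; lra.
have t0 : 0 <= t by rewrite /t le_max lexx.
have t'0 : 0 <= t' by rewrite /t' le_max lexx.
case: eqP => // ne; rewrite ge_min; apply/orP; right.
move: ne tt'; case: eqP => [->|_]; case: eqP => [->|_] // _.
  by rewrite !add0r normrN ger0_norm.
by rewrite !addr0 subr0 ger0_norm.
Qed.

Lemma spineE p : spine (foot p) (tip p) (height p) = p.
Proof.
have /andP[p0 p1] := height_itv p.
have e : Num.max 0 (Num.min 1 (height p)) = height p.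
  by rewrite (min_idPr p1) (max_idPr p0).
apply: cobweb_eq => //; rewrite /tip/height/= e //.
by case: eqP => // /tip_apex.
Qed.

Lemma spine0 y x x' : spine y x 0 = spine y x' 0.
Proof.
have e : Num.max 0 (Num.min 1 0) = 0 :> R by rewrite (min_idPr ler01) maxxx.
by apply: cobweb_eq => //; rewrite /tip/= e eqxx.
Qed.

(** The tip comes first, so that [graft x] is a section of [foot]. *)
Definition graft (x y : Y) : cobweb := spine y x 1.

Lemma graftE x y :
  (foot (graft x y) = y) * (tip (graft x y) = x) * (height (graft x y) = 1).
Proof.
have e : Num.max 0 (Num.min 1 1) = 1 :> R by rewrite minxx (max_idPr ler01).
by rewrite /foot/tip/height/= e oner_eq0.
Qed.

Lemma graft_lip x y : mdist (graft x x) (graft x y) <= mdist x y.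
Proof.
rewrite cobweb_mdistE !graftE eqxx mdistxx.
case: eqP => [->|_]; first by rewrite subrr normr0 mdistxx.
by rewrite ge_min metric_sym; apply/orP; right; lra.
Qed.
End CobwebSpace.

(** * Completeness of the cobweb *)

Section CobwebComplete.
Context {R : realType}.

Lemma real_complete : complete_space R^o.
Proof. by move=> F PF cF; exists (lim F); exact: (@cauchy_cvg R^o). Qed.

(** Heights move by less than [1 / 4], so a change of foot from the lower half, or of tip from the
    upper half, would cost more than [1 / 4]. *)
Lemma foot_tip_near (Y : metricType R) (p q : cobweb Y) : mdist p q < 1 / 4 ->
  if height p <= 1 / 2 then foot p = foot q else tip p = tip q.
Proof.
have /andP[p0 p1] := height_itv p; have /andP[q0 q1] := height_itv q.
have d0 := mdist_ge0 (foot p) (tip p); have d'0 := mdist_ge0 (foot q) (tip q).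
move=> h; have := le_lt_trans (height_lip p q) h.
rewrite ltr_norml => /andP[h1 h2]; move: h; rewrite cobweb_mdistE.
case: eqP => [?|_]; case: eqP => [?|_]; rewrite ?minEle;
  repeat (case: ifP => // * ); exfalso; lra.
Qed.

(** Heights converge, and the foot or the tip is eventually constant. If both are, the limit lies on
    that spine. If only the foot is, points with distinct tips come arbitrarily close, which forces
    the limit to be the apex; if only the tip is, the limit is the centre of the star. *)
Lemma cobweb_complete (Y : metricType R) : complete_space (cobweb Y).
Proof.
move=> F PF cF.
have [t ht] : exists t : R^o, height p @[p --> F] --> t.
  apply: real_complete; apply: cauchy_exP => e e0.
  have [A FA dA] := cauchy_mdist PF cF e0.
  have [a Aa] := filter_ex FA.
  exists (height a); apply: (@filterS _ F _ A) => // b Ab.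
  by rewrite /= -ball_normE /=; apply: (le_lt_trans (height_lip a b)); exact: dA.
have {ht}Ft (e : R) : 0 < e -> F [set p | `|t - height p| < e].
  by move=> e0; exact: (ht _ (nbhsx_ballx t e e0)).
have [A0 FA0 dA0] : exists2 A, F A & forall a b : cobweb Y, A a -> A b ->
  mdist a b < 1 / 4 by apply: cauchy_mdist => //; lra.
have [a0 Aa0] := filter_ex FA0.
have FS : (exists y, F [set p | foot p = y]) \/ (exists x, F [set p | tip p = x]).
  have [a1|a1] := leP (height a0) (1 / 2);
    [left; exists (foot a0)|right; exists (tip a0)];
    apply: filterS FA0 => b Ab /=; have := foot_tip_near (dA0 _ _ Aa0 Ab).
    by rewrite a1.
  by rewrite leNgt a1.
have small (e : R) : 0 < e -> exists2 A, F A & forall a b : cobweb Y, A a -> A b ->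
  mdist a b < e /\ mdist a b < 1.
  move=> e0; have m0 : 0 < Num.min e 1 by rewrite lt_min e0 ltr01.
  have [A FA dA] := cauchy_mdist PF cF m0.
  by exists A => // a b Aa Ab; have := dA _ _ Aa Ab; rewrite lt_min => /andP[].
have [[y Fy]|nFy] := pselect (exists y, F [set p | foot p = y]);
  have [[x Fx]|nFx] := pselect (exists x, F [set p | tip p = x]); last by case: FS.
- exists (spine y x t); apply: cvg_mdist => e e0.
  near=> p; have py : foot p = y by near: p.
  have px : tip p = x by near: p.
  rewrite /= -(spineE p) py px; apply: le_lt_trans (spine_lip _ _ _ _) _.
  by near: p; exact: Ft.
- exists (spine y y 0); apply: cvg_mdist => e e0; have [A FA dA] := small _ e0.
  have : F (A `&` [set p | foot p = y]) by exact: filterI.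
  apply: filterS => b [Ab /= yb].
  have [b' [Ab' y'b bb']] : exists b', [/\ A b', foot b' = y & tip b <> tip b'].
    apply: contra_notP nFx => /forallNP nb'; exists (tip b).
    have : F (A `&` [set p | foot p = y]) by exact: filterI.
    apply: filterS => b' [Ab' /= yb']; apply: contrapT => bb'.
    by apply: (nb' b'); split => // /esym.
  rewrite -(spineE b) yb (spine0 _ y (tip b)).
  apply: le_lt_trans (spine_lip _ _ _ _) _; rewrite add0r normrN.
  have /andP[b0 b1] := height_itv b; have /andP[b'0 b'1] := height_itv b'.
  have := dA _ _ Ab Ab'; rewrite cobweb_mdistE yb y'b eqxx; case: eqP => // _.
  rewrite ger0_norm // minEle; case: ifP => _ [] *; lra.
- exists (graft x x); apply: cvg_mdist => e e0; have [A FA dA] := small _ e0.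
  have : F (A `&` [set p | tip p = x]) by exact: filterI.
  apply: filterS => b [Ab /= xb].
  have [b' [Ab' x'b bb']] : exists b', [/\ A b', tip b' = x & foot b <> foot b'].
    apply: contra_notP nFy => /forallNP nb'; exists (foot b).
    have : F (A `&` [set p | tip p = x]) by exact: filterI.
    apply: filterS => b' [Ab' /= xb']; apply: contrapT => bb'.
    by apply: (nb' b'); split => // /esym.
  have /andP[b0 b1] := height_itv b; have /andP[b'0 b'1] := height_itv b'.
  have := dA _ _ Ab Ab'; rewrite 2!cobweb_mdistE xb x'b !graftE !eqxx.
  have := mdist_ge0 (foot b) x; have := mdist_ge0 (foot b') x.
  case: eqP => // _; rewrite mdistxx !minEle; case: ifP => _ * ; first lra.
  case: eqP => _; first by rewrite ger0_norm; lra.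
  case: ifP => *; lra.
Unshelve. all: by end_near. Qed.
End CobwebComplete.

(** * Connectedness through locally constant predicates *)

Section LocallyConstant.
Context {R : realType}.

Definition locally_constant (T : metricType R) (K : set T) (P : T -> Prop) :=
  forall y, K y -> exists2 e, 0 < e &
    forall y', K y' -> mdist y y' < e -> (P y <-> P y').

Definition lc_connected (T : metricType R) (K : set T) :=
  forall P, locally_constant K P -> forall y y', K y -> K y' -> P y -> P y'.

Lemma connected_lc (T : metricType R) (K : set T) :
  connected K -> lc_connected K.
Proof.
move=> cK P lcP y y' Ky Ky' Py.
have nP Q : locally_constant K Q ->
    exists2 C, open C & K `&` [set a | Q a] = K `&` C.
  move=> lcQ; exists (interior [set a | K a -> Q a]); first exact: open_interior.
  apply/seteqP; split=> a [Ka h]; split=> //; last exact: (interior_subset h).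
  have [e e0 he] := lcQ a Ka; apply/nbhs_ballP; exists e => // b.
  by rewrite ballEmdist /= => ab Kb; apply/(he _ Kb ab).
have [C oC KC] := nP _ lcP.
have [D oD KD] : exists2 C, open C & K `&` [set a | ~ P a] = K `&` C.
  apply: nP => a Ka; have [e e0 he] := lcP a Ka; exists e => // b Kb ab.
  by rewrite (he b Kb ab).
have : K `&` [set a | P a] = K.
  apply: cK; [by exists y | by exists C | exists (~` D)].
    by rewrite closedC.
  apply/seteqP; split=> a [Ka h]; split => //=.
    by move=> Da; have : (K `&` D) a by []; rewrite -KD => -[].
  by apply: contrapT => nPa; apply: h; have : (K `&` [set a | ~ P a]) a by []; rewrite KD => -[].
by move=> /seteqP[_ /(_ _ Ky')[]].
Qed.

Lemma lc_connected_connected (T : metricType R) :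
  lc_connected [set: T] -> connected [set: T].
Proof.
move=> lcT B [b Bb] [C oC BC] [D cD BD]; rewrite setTI in BC; rewrite setTI in BD.
subst C; apply/seteqP; split=> // a _; apply: (lcT _ _ b) => // y _.
have [By|nBy] := pselect (B y).
  have /nbhs_ballP[e /= e0 he] : nbhs y B by exact: open_nbhs_nbhs.
  exists e => // z _ yz; split=> // _; apply: he; by rewrite ballEmdist.
have /nbhs_ballP[e /= e0 he] : nbhs y (~` B).
  by apply: open_nbhs_nbhs; split=> //; rewrite openC BD.
exists e => // z _ yz; split=> // Bz; exfalso; apply: (he z) => //.
by rewrite ballEmdist.
Qed.

Lemma real_lc_connected : lc_connected [set: R^o].
Proof. by apply: connected_lc; apply/connected_intervalP. Qed.

(** Each spine is a Lipschitz image of the line, and all spines over [y] share the apex. *)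
Lemma fiber_lc_connected (Y : metricType R) (y : Y) :
  lc_connected [set p : cobweb Y | foot p = y].
Proof.
move=> P lcP.
suff apex p : foot p = y -> (P p <-> P (spine y y 0)).
  by move=> p q /= /apex -> /apex ->.
move=> py; rewrite -(spineE p) py (spine0 _ y (tip p)).
have lcQ : locally_constant [set: R^o] (fun s => P (spine y (tip p) s)).
  move=> s _; have [//|e e0 he] := lcP (spine y (tip p) s).
  exists e => // s' _ ss'; apply: he => //.
  by apply: le_lt_trans (spine_lip _ _ _ _) _; rewrite distrC.
by split; apply: (real_lc_connected lcQ).
Qed.
End LocallyConstant.

(** * Inverse limits of metric spaces *)

Section Threads.
Context {R : realType} (Y : nat -> metricType R) (f : forall n, Y n.+1 -> Y n).

Record thread := Thread {
  stage : forall n, Y n;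
  stageS : forall n, f (stage n.+1) = stage n }.

HB.instance Definition _ := gen_eqMixin thread.
HB.instance Definition _ := gen_choiceMixin thread.

Implicit Types z w : thread.

Lemma thread_eq z w : (forall n, stage z n = stage w n) -> z = w.
Proof.
case: z w => [z hz] [w hw] /= zw.
have ? : z = w by exact: functional_extensionality_dep.
by subst w; congr Thread; exact: Prop_irrelevance.
Qed.

(** The caps tend to [0], so the supremum of the terms induces the inverse limit topology. Unlike a
    series, it takes only the values [0], caps and stage distances, which keeps distance sets
    countable. *)
Let term z w n : R := Num.min n.+1%:R^-1 (mdist (stage z n) (stage w n)).

Let dist z w : R := sup (range (term z w)).

Let term_ge0 z w n : 0 <= term z w n.
Proof. by rewrite le_min invr_ge0 ler0n mdist_ge0. Qed.

Let dist_has_sup z w : has_sup (range (term z w)).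
Proof.
split; first by exists (term z w 0); exists 0%N.
by exists 1 => _ [n _ <-]; rewrite ge_min invf_le1 // ler1n.
Qed.

Let term_le z w n : term z w n <= dist z w.
Proof. by apply: sup_upper_bound; [exact: dist_has_sup | exists n]. Qed.

Let dist_le z w e : (forall n, term z w n <= e) -> dist z w <= e.
Proof.
move=> h; apply: ge_sup; first by exists (term z w 0); exists 0%N.
by move=> _ [n _ <-].
Qed.

Let dist_ge0 z w : 0 <= dist z w.
Proof. exact: le_trans (term_ge0 z w 0) (term_le z w 0). Qed.

Let distxx z : dist z z = 0.
Proof.
apply/eqP; rewrite eq_le dist_ge0 andbT; apply: dist_le => n.
by rewrite /term mdistxx ge_min lexx orbT.
Qed.

Let dist_eq0 z w : dist z w = 0 -> z = w.
Proof.
move=> zw; apply: thread_eq => n; apply: (@mdist_positivity R).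
apply/eqP; rewrite eq_le mdist_ge0 andbT.
by have := term_le z w n; rewrite zw ge_min leNgt invr_gt0 ltr0Sn.
Qed.

Let dist_sym z w : dist z w = dist w z.
Proof.
have e : term z w = term w z by apply/funext => n; rewrite /term metric_sym.
by rewrite /dist e.
Qed.

Let dist_triangle w z u : dist z u <= dist z w + dist w u.
Proof.
apply: dist_le => n; apply: (le_trans _ (lerD (term_le z w n) (term_le w u n))).
have := metric_triangle (stage z n) (stage w n) (stage u n).
have := mdist_ge0 (stage z n) (stage w n).
have := mdist_ge0 (stage w n) (stage u n).
have : 0 <= n.+1%:R^-1 :> R by rewrite invr_ge0.
rewrite /term; move: (_^-1) => i; rewrite !minEle; do 3?[case: ifP => * ]; lra.
Qed.

HB.instance Definition _ := @isMetric.Build R thread dist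
  distxx dist_eq0 dist_sym dist_triangle.

Lemma thread_mdist_le z w e :
  (forall n, mdist (stage z n) (stage w n) <= e) -> mdist z w <= e.
Proof. by move=> h; apply: dist_le => n; rewrite ge_min h orbT. Qed.

Lemma stage_mdist_lt z w n e : e <= n.+1%:R^-1 -> mdist z w < e ->
  mdist (stage z n) (stage w n) < e.
Proof.
move=> en zw; have := le_lt_trans (term_le z w n) zw.
by rewrite gt_min ltNge en.
Qed.

(* A positive supremum is a maximum, the terms being bounded by [n.+1%:R^-1]. *)
Lemma thread_mdist_values z w : mdist z w = 0 \/
  exists n, mdist z w = n.+1%:R^-1 \/ mdist z w = mdist (stage z n) (stage w n).
Proof.
have [->|dn0] := eqVneq (mdist z w) 0; [by left | right].
have d0 : 0 < mdist z w by rewrite lt_neqAle eq_sym dn0 mdist_ge0.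
suff [n ->] : exists n, mdist z w = term z w n.
  by exists n; rewrite /term minEle; case: ifP; [left|right].
apply: contrapT => /forallNP nd.
have lt n : term z w n < mdist z w.
  by rewrite lt_neqAle term_le andbT; apply/eqP => /esym; exact: nd.
have [N hN] : exists N, N.+1%:R^-1 < mdist z w.
  exists (Num.truncn (mdist z w)^-1).
  by rewrite invf_plt ?posrE // truncnS_gt.
have [e elt he] : exists2 e, e < mdist z w & forall n, (n < N)%N -> term z w n <= e.
  elim: (N) => [|M [e elt he]]; first by exists 0.
  exists (Num.max e (term z w M)); first by rewrite gt_max elt lt.
  by move=> n; rewrite ltnS leq_eqVlt le_max => /orP[/eqP ->|/he ->]//; rewrite lexx orbT.
have : mdist z w <= Num.max e N.+1%:R^-1.
  apply: dist_le => n; rewrite le_max; have [/he -> //|Nn] := ltnP n N.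
  apply/orP; right; rewrite ge_min lef_pV2 ?posrE // ler_nat ltnS Nn //.
by rewrite le_max leNgt elt leNgt hN.
Qed.

Hypothesis fP : forall n (p q : Y n.+1), mdist p q < 1 -> mdist (f p) (f q) <= mdist p q.

Lemma stage_mdist_mono z w n m : (n <= m)%N ->
  mdist (stage z m) (stage w m) < 1 ->
  mdist (stage z n) (stage w n) <= mdist (stage z m) (stage w m).
Proof.
move=> /subnK <-; elim: (m - n)%N => [//|k IHk]; rewrite addSn => h.
have h' := fP h; rewrite !stageS in h'.
by apply: (le_trans _ h'); apply: IHk; exact: le_lt_trans h' h.
Qed.

(** One stage suffices: earlier stages are controlled by [stage_mdist_mono], and at later ones the
    caps are at most [e / 2]. *)
Lemma thread_mdist_lt e : 0 < e -> exists n d, 0 < d /\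
  forall z w, mdist (stage z n) (stage w n) < d -> mdist z w < e.
Proof.
move=> e0; exists (Num.truncn (e / 2)^-1), (Num.min 1 (e / 2)).
have e20 : 0 < e / 2 by lra.
split=> [|z w]; first by rewrite lt_min ltr01.
set N := Num.truncn _; rewrite lt_min => /andP[d1 d2].
apply: (@le_lt_trans _ _ (e / 2)); last by lra.
apply: dist_le => n; rewrite ge_min; have [nN|Nn] := leqP n N.
  by rewrite (le_trans (stage_mdist_mono nN d1) (ltW d2)) orbT.
rewrite invf_ple ?posrE // (le_trans (ltW (truncnS_gt _))) // ler_nat ltnS.
exact: ltnW.
Qed.

Lemma thread_complete : (forall n, complete_space (Y n)) -> complete_space thread.
Proof.
move=> cY F PF cF.
have lim n : {l : Y n | forall e : R, 0 < e -> F [set z | mdist l (stage z n) < e]}.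
  apply: cid; have [l hl] : exists l : Y n, (stage z n @[z --> F]) --> l.
    apply: cY; apply: cauchy_exP => e e0.
    (* Below the cap of stage [n], the distance of threads bounds that of their stages. *)
    have m0 : 0 < Num.min e n.+1%:R^-1 by rewrite lt_min e0 invr_gt0 ltr0Sn.
    have [A FA dA] := cauchy_mdist PF cF m0.
    have [a Aa] := filter_ex FA.
    exists (stage a n); apply: (@filterS _ F _ A) => // b Ab.
    rewrite /= ballEmdist /=.
    have lt : mdist (stage a n) (stage b n) < Num.min e n.+1%:R^-1.
      by apply: stage_mdist_lt; [rewrite ge_min lexx orbT | exact: dA].
    by apply: lt_le_trans lt _; rewrite ge_min lexx.
  exists l => e e0; have := hl _ (nbhsx_ballx l e e0).
  by rewrite ballEmdist.
have fl n : f (sval (lim n.+1)) = sval (lim n).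
  case: (lim n) => l hl; case: (lim n.+1) => l' hl' /=.
  apply: (@mdist_positivity R); apply/eqP; rewrite eq_le mdist_ge0 andbT.
  apply/ler_addgt0Pl => e e0; rewrite addr0.
  have m0 : 0 < Num.min 1 (e / 2) by rewrite lt_min ltr01; lra.
  have e20 : 0 < e / 2 by lra.
  have : F ([set z | mdist l (stage z n) < e / 2] `&`
            [set z | mdist l' (stage z n.+1) < Num.min 1 (e / 2)]).
    by apply: filterI; [exact: hl | exact: hl'].
  move=> /filter_ex[z [/= h1]]; rewrite lt_min => /andP[h2 h3].
  have := fP h2; rewrite stageS => h4.
  have := metric_triangle (f l') (stage z n) l; rewrite (metric_sym (stage z n)); lra.
exists (Thread fl); apply: cvg_mdist => e /thread_mdist_lt[n [d [d0 hd]]].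
by apply: filterS (svalP (lim n) d d0) => z zd; exact: (hd (Thread fl)).
Qed.
End Threads.

(** * Connectedness of the inverse limit *)

Section Connected.
Context {R : realType}.

(** A section of the limit over stage [n], continuous at [y]: lower stages are projections, higher
    ones iterate [s]. *)
Lemma thread_section n (Y : nat -> metricType R) (f : forall n, Y n.+1 -> Y n)
    (s : forall n, Y n -> Y n -> Y n.+1) :
  (forall n (p q : Y n.+1), mdist p q < 1 -> mdist (f n p) (f n q) <= mdist p q) ->
  (forall n (x y : Y n), f n (s n x y) = y) ->
  (forall n (x y : Y n), mdist (s n x x) (s n x y) <= mdist x y) ->
  forall y : Y n, exists t : Y n -> thread f, (forall y', stage (t y') n = y') /\
    forall y', mdist y y' < 1 ->
    forall m, mdist (stage (t y) m) (stage (t y') m) <= mdist y y'.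
Proof.
(* Inducting over all towers and dropping their first level keeps the types of the
   stages definitionally aligned. *)
elim: n => [|n IHn] in Y f s * => fP fs sP y.
  (* All lifts use the sections centred on the thread [c] of [y]; so [y] lifts to [c], and [sP]
     passes the bound from stage to stage. *)
  pose c := fix c m : Y m := if m is k.+1 then s k (c k) (c k) else y.
  pose t y' := fix t m : Y m := if m is k.+1 then s k (c k) (t k) else y'.
  have fy y' m : f m (t y' m.+1) = t y' m by exact: fs.
  have ty m : t y m = c m by elim: m => //= m ->.
  exists (fun y' => Thread (fy y')); split => // y' _.
  elim=> [//|m IHm]; rewrite /= ty in IHm *.
  by apply: le_trans IHm; exact: sP.
have [t [tK tP]] := IHn (fun m => Y m.+1) (fun m => f m.+1) (fun m => s m.+1)
  (fun m => fP m.+1) (fun m => fs m.+1) (fun m => sP m.+1) y.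
pose u y' m : Y m := if m is k.+1 then stage (t y') k else f 0 (stage (t y') 0).
have fu y' m : f m (u y' m.+1) = u y' m by case: m => //= m; exact: stageS.
exists (fun y' => Thread (fu y')); split=> // y' yy' [|m] /=; last exact: tP.
by apply: le_trans (tP _ yy' 0); apply: fP; exact: le_lt_trans (tP _ yy' 0) yy'.
Qed.

Lemma thread_lc_connected (Y : nat -> metricType R) (f : forall n, Y n.+1 -> Y n)
    (s : forall n, Y n -> Y n -> Y n.+1) :
  (forall n (p q : Y n.+1), mdist p q < 1 -> mdist (f n p) (f n q) <= mdist p q) ->
  (forall n (x y : Y n), f n (s n x y) = y) ->
  (forall n (x y : Y n), mdist (s n x x) (s n x y) <= mdist x y) ->
  lc_connected [set: Y 0] ->
  (forall n (y : Y n), lc_connected [set p | f n p = y]) ->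
  lc_connected [set: thread f].
Proof.
move=> fP fs sP Y0c fc P lcP z0 w0 _ _ Pz0; apply: contrapT => nPw0.
pose split n (y : Y n) := exists z w : thread f,
  [/\ stage z n = y, stage w n = y, P z & ~ P w].
(* If no point of [K] splits, [P] descends to the predicate [Q] on [K]. Composing [P] with a section
   continuous at [y] shows that [Q] is locally constant at [y], so [P] cannot separate [z] from
   [w]. *)
have step n (K : set (Y n)) (z w : thread f) : lc_connected K ->
    K (stage z n) -> K (stage w n) -> P z -> ~ P w -> exists2 y, K y & split n y.
  move=> cK Kz Kw Pz nPw; apply: contrapT => nsplit.
  have hom z' w' : K (stage z' n) -> stage z' n = stage w' n -> P z' -> P w'.
    move=> Kz' zw' Pz'; apply: contrapT => nPw'; apply: nsplit.
    by exists (stage z' n) => //; exists z', w'.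
  pose Q y := exists2 z', stage z' n = y & P z'.
  have lcQ : locally_constant K Q.
    move=> y Ky; have [t [tK tP]] := thread_section fP fs sP y.
    have Qt y' : K y' -> Q y' <-> P (t y').
      move=> Ky'; split=> [[z' z'y' Pz']|]; last by exists (t y').
      by apply: (hom z') => //; rewrite z'y' ?tK.
    have [//|e e0 he] := lcP (t y).
    exists (Num.min e 1) => [|y' Ky']; first by rewrite lt_min e0 ltr01.
    rewrite lt_min => /andP[ye y1]; rewrite (Qt _ Ky) (Qt _ Ky').
    apply: he => //; apply: le_lt_trans ye; apply: thread_mdist_le; exact: tP.
  have [|w' w'w Pw'] := cK _ lcQ _ _ Kz Kw; first by exists z.
  by apply: nPw; apply: (hom w') => //; rewrite w'w.
have [y0 _ sy0] := step 0 _ _ _ Y0c I I Pz0 nPw0.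
(* Each splitting point is chosen over the previous one, so that they form a thread. *)
have next n (y : {y | split n y}) : {y' : {y' | split n.+1 y'} | f n (sval y') = sval y}.
  apply: cid; case: y => y [z [w [zy wy Pz nPw]]] /=.
  have [||y' fy' sy'] := step n.+1 [set p | f n p = y] z w (fc n y) _ _ Pz nPw;
    rewrite /= ?stageS//.
  by exists (exist _ y' sy').
pose c := fix c n : {y | split n y} :=
  if n is k.+1 then sval (next k (c k)) else exist _ y0 sy0.
pose l := @Thread _ _ f (fun n => sval (c n)) (fun n => svalP (next n (c n))).
(* Threads sharing a late enough stage with [l] are within [e] of it, yet [P] takes both values on
   them. *)
have [//|e e0 he] := lcP l.
have [n [d [d0 hd]]] := thread_mdist_lt fP e0.
have [z [w [zn wn Pz nPw]]] := svalP (c n).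
apply: nPw; apply/he => //; first by apply: hd; rewrite /= wn mdistxx.
by apply/(he z) => //; apply: hd; rewrite /= zn mdistxx.
Qed.
End Connected.

(** * Clopen balls from countable distance sets *)

Section CountableDistances.
Context {R : realType}.

(** Countable sets are Lebesgue null, intervals of positive length are not. *)
Lemma countable_gap (C : set R) (e : R) : countable C -> 0 < e ->
  exists r, [/\ 0 < r, r < e & ~ C r].
Proof.
move=> cC e0; apply: contrapT => h.
have sub : `]0, e[%classic `<=` C.
  move=> r; rewrite /= in_itv /= => /andP[r0 re]; apply: contrapT => nCr.
  by apply: h; exists r.
have : lebesgue_measure (`]0, e[%classic : set R) = 0%E.
  apply: countable_lebesgue_measure0; exact: sub_countable (subset_card_le sub) cC.
rewrite lebesgue_measure_itv /= lte_fin e0 oppr0 adde0 => -[] e0'.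
by rewrite e0' ltxx in e0.
Qed.

Context {T : metricType R} (A : set T).
Hypothesis cA : forall a, A a -> countable [set mdist a b | b in A].

(** At a radius that is not a distance from [a], the open and the closed ball have the same trace on
    [A]. *)
Lemma clopen_ball (a : T) (e : R) : A a -> 0 < e -> exists r,
  [/\ 0 < r, r < e & forall b, A b -> (mdist a b < r) = (mdist a b <= r)].
Proof.
move=> Aa e0; have [r [r0 re nr]] := countable_gap (cA Aa) e0.
exists r; split=> // b Ab; rewrite le_eqVlt; case: eqP => //= abr.
by case: nr; exists b.
Qed.

Lemma open_mdist_lt (a : T) (r : R) : open [set b | mdist a b < r].
Proof.
rewrite openE => b /= abr; apply/nbhs_ballP; exists (r - mdist a b) => /=.
  by rewrite subr_gt0.
move=> c; rewrite ballEmdist /= => bc.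
by have := metric_triangle a b c; lra.
Qed.

Lemma closed_mdist_le (a : T) (r : R) : closed [set b | mdist a b <= r].
Proof.
rewrite -openC openE => b /= /negP; rewrite -ltNge => abr.
apply/nbhs_ballP; exists (mdist a b - r) => /=; first by rewrite subr_gt0.
move=> c; rewrite ballEmdist /= => bc; apply/negP; rewrite -ltNge.
by have := metric_triangle a c b; rewrite (metric_sym c); lra.
Qed.

Lemma countable_mdist_zero_dimensional : zero_dimensional_space A.
Proof.
exists clopen => //; split=> [U [] //|x U].
rewrite nbhsE => -[_ [[V oV <-] Vx] VU].
have /nbhs_ballP[e /= e0 he] : nbhs (val x) V by exact: open_nbhs_nbhs.
have Aa (y : A) : A (val y) by exact: set_valP.
have [r [r0 re hr]] := clopen_ball (Aa x) e0.
exists (val @^-1` [set b | mdist (val x) b < r]) => [|y /= xy].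
  split; last by rewrite /= mdistxx.
  split; first by exists [set b | mdist (val x) b < r] => //; exact: open_mdist_lt.
  have -> : val @^-1` [set b | mdist (val x) b < r] =
    (val : A -> T) @^-1` [set b | mdist (val x) b <= r].
    by apply/funext => y /=; rewrite (hr _ (Aa y)).
  rewrite -openC; exists (~` [set b | mdist (val x) b <= r]) => //.
  by rewrite openC; exact: closed_mdist_le.
by apply: VU; apply: he; rewrite ballEmdist /=; exact: lt_trans xy re.
Qed.

Lemma countable_mdist_connected : A !=set0 -> connected A ->
  exists x : T, A = [set x].
Proof.
move=> [a Aa] cnA; exists a; apply/seteqP; split=> [b Ab /=|_ ->//].
apply: contrapT => ba.
have ab0 : 0 < mdist a b by rewrite mdist_gt0; apply/eqP => /esym.
have [r [r0 rab hr]] := clopen_ball Aa ab0.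
have /seteqP[_ /(_ b Ab)[_ /=]] : A `&` [set c | mdist a c < r] = A.
  apply: cnA.
  - by exists a; split; rewrite //= mdistxx.
  - by exists [set c | mdist a c < r] => //; exact: open_mdist_lt.
  - exists [set c | mdist a c <= r]; first exact: closed_mdist_le.
    by apply/seteqP; split=> c [Ac /=]; rewrite hr.
by rewrite ltNge (ltW rab).
Qed.
End CountableDistances.

(** * Countability from separability *)

Section SeparableThreads.
Context {R : realType} (Y : nat -> metricType R) (f : forall n, Y n.+1 -> Y n).
Variable (t : forall n, Y n.+1 -> Y n).
Hypothesis near_f : forall n (p : Y n.+1), exists2 e, 0 < e &
  forall q, mdist p q < e -> f p = f q \/ f p = t q.

(** Each [z] has a member [d] of the dense set so close that [near_f], used one stage higher, leaves
    only two values read off [d] for [stage z n]. *)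
Lemma separable_stage (A : set (thread f)) n : separable_space A ->
  countable [set stage z n | z in A].
Proof.
move=> [D cD dD].
apply: (@sub_countable _ _ _ (\bigcup_(d in D)
  [set stage (val d) n; t (stage (val d) n.+1)])); last first.
  by apply: bigcup_countable => // d _; apply: finite_set_countable; exact: finite_set2.
apply: subset_card_le => _ [z Az <-].
have [e e0 he] := near_f (stage z n.+1).
(* [n.+2%:R^-1] is the cap of stage [n.+1]. *)
have m0 : 0 < Num.min e n.+2%:R^-1 by rewrite lt_min e0 invr_gt0 ltr0Sn.
have [||d [zd Dd]] :=
  dD ((val : A -> thread f) @^-1` [set w | mdist z w < Num.min e n.+2%:R^-1]).
- by exists (exist _ z (mem_set Az)); rewrite /= mdistxx.
- by exists [set w | mdist z w < Num.min e n.+2%:R^-1] => //; exact: open_mdist_lt.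
exists d => //=; rewrite -(stageS z) -(stageS (val d)); apply: he.
have : mdist (stage z n.+1) (stage (val d) n.+1) < Num.min e n.+2%:R^-1.
  by apply: stage_mdist_lt => //; rewrite ge_min lexx orbT.
by rewrite lt_min => /andP[].
Qed.

(** By [thread_mdist_values], a distance is one of three values given by a stage number and a point
    of a countable projection. *)
Lemma separable_countable_mdist (A : set (thread f)) (a : thread f) :
  separable_space A -> countable [set mdist a z | z in A].
Proof.
move=> sA; apply: (@sub_countable _ _ _ (\bigcup_n
  \bigcup_(y in [set stage z n | z in A])
    [set x | x \in [:: 0; n.+1%:R^-1; mdist (stage a n) y]])); last first.
  apply: bigcup_countable => // n _; apply: bigcup_countable => [|y _].
    exact: separable_stage.
  by apply: finite_set_countable; exact: finite_seq.
apply: subset_card_le => _ [z Az <-].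
suff [n zn] : exists n,
    mdist a z \in [:: 0; n.+1%:R^-1; mdist (stage a n) (stage z n)].
  by exists n => //; exists (stage z n) => //; exists z.
by have [->|[n [->|->]]] := thread_mdist_values a z; [exists 0%N|exists n|exists n];
  rewrite !inE eqxx ?orbT.
Qed.
End SeparableThreads.

(** * The tower of cobwebs over the real line *)

Section Cobwebs.
Variable R : realType.

Fixpoint cobwebs n : metricType R := if n is m.+1 then cobweb (cobwebs m) else R^o.

Definition cobweb_limit : metricType R :=
  @thread R cobwebs (fun n => @foot R (cobwebs n)).

Lemma cobweb_limit_complete : complete_space cobweb_limit.
Proof.
apply: thread_complete => [n p q|[|n]].
- exact: foot_lip.
- exact: real_complete.
- exact: cobweb_complete.
Qed.

Lemma cobweb_limit_connected : connected [set: cobweb_limit].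
Proof.
apply: lc_connected_connected.
apply: (@thread_lc_connected R _ _ (fun n => @graft R (cobwebs n))).
- by move=> n p q; exact: foot_lip.
- by [].
- by move=> n x y; exact: graft_lip.
- exact: real_lc_connected.
- by move=> n y; exact: fiber_lc_connected.
Qed.

Lemma cobweb_limit_two_points : two_points cobweb_limit.
Proof.
have [|||t [tK _]] := @thread_section R 0 cobwebs (fun n => @foot R (cobwebs n))
  (fun n => @graft R (cobwebs n)) _ _ _ (0 : R^o).
- by move=> n p q; exact: foot_lip.
- by [].
- by move=> n x y; exact: graft_lip.
exists (t 0), (t 1) => t01; have := tK (1 : R^o); rewrite -t01 tK.
by move/eqP; rewrite eq_sym oner_eq0.
Qed.

Lemma cobweb_limit_countable_mdist (A : set cobweb_limit) (a : cobweb_limit) :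
  separable_space A -> countable [set mdist a z | z in A].
Proof.
apply: (separable_countable_mdist (t := fun n => @tip R (cobwebs n))) => n p.
exact: foot_near.
Qed.
End Cobwebs.

Theorem corollary19 (R : realType) :
  (exists X : metricType R,
     [/\ complete_space X, connected [set: X], two_points X &
         forall A : set X, separable_space A -> zero_dimensional_space A]) /\
  (exists X : metricType R,
     [/\ complete_space X, two_points X & nonseparably_connected X]).
Proof.
have cX := @cobweb_limit_complete R; have nX := @cobweb_limit_connected R.
have tX := @cobweb_limit_two_points R; have dX := @cobweb_limit_countable_mdist R.
split; exists (cobweb_limit R); split => //.
- by move=> A sA; apply: countable_mdist_zero_dimensional => a _; exact: dX.
- split=> // A A0 cA sA; apply: countable_mdist_connected => // a _; exact: dX.
Qed.
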